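(* Let $\big((A\oplus A^*,\cdot_d,P+Q^*,\mathcal B_d),(A,\cdot_A,P),(A^*,\cdot_{A^*},Q^* )\big)$ be a double construction of averaging Frobenius commutative algebra, where $P,Q:A\to A$ are linear maps. Then there is a Manin triple of special apre-perm algebras $\big((A\oplus A^*,\triangleright_d,\triangleleft_d,\mathcal B_d),(A,\triangleright_A,\triangleleft_A),(A^*,\triangleright_{A^*},\triangleleft_{A^*})\big)$, where for all $x,y\in A$, $a^*,b^*\in A^*$, $$(x+a^* )\triangleright_d(y+b^* )=(P+Q^* )(x+a^* )\cdot_d(y+b^* )+(Q+P^* )\big((x+a^* )\cdot_d(y+b^* )\big),$$ $$(x+a^* )\triangleleft_d(y+b^* )=-(Q+P^* )\big((x+a^* )\cdot_d(y+b^* )\big).$$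
   Context: All vector spaces and algebras are finite-dimensional over an algebraically closed field $\mathbb K$ of characteristic zero; ''commutative algebra'' means commutative associative algebra. For a linear map $\beta:V\to V$, $\beta^*:V^*\to V^*$ is its transpose. For $\phi_i:V_i\to V_i$, $\phi_1+\phi_2$ on $V_1\oplus V_2$ is $v_1+v_2\mapsto\phi_1(v_1)+\phi_2(v_2)$. $\mathcal B_d$ denotes the bilinear form on $A\oplus A^*$ given by $\mathcal B_d(x+a^*,y+b^* )=\langle x,b^*\rangle+\langle a^*,y\rangle$. An averaging operator on a commutative algebra $(A,\cdot_A)$ is a linear map $P$ with $P(x)\cdot_A P(y)=P(P(x)\cdot_A y)$. A double construction of averaging Frobenius commutative algebra $\big((A\oplus A^*,\cdot_d,P+Q^*,\mathcal B_d),(A,\cdot_A,P),(A^*,\cdot_{A^*},Q^* )\big)$ consists of commutative algebras $(A,\cdot_A)$, $(A^*,\cdot_{A^*})$, a commutative algebra structure $\cdot_d$ on $A\oplus A^*$ containing both as subalgebras with $\mathcal B_d$ invariant ($\mathcal B_d(u\cdot_d v,w)=\mathcal B_d(u,v\cdot_d w)$), an averaging operator $P$ on $(A,\cdot_A)$ and an averaging operator $Q^*$ on $(A^*,\cdot_{A^*})$ such that $P+Q^*$ is an averaging operator on $(A\oplus A^*,\cdot_d)$. A perm algebra $(A,\circ_A)$ is a vector space with a bilinear operation satisfying $x\circ_A(y\circ_A z)=(x\circ_A y)\circ_A z=(y\circ_A x)\circ_A z$. An apre-perm algebra is a vector space $A$ with multiplications $\triangleright_A,\triangleleft_A:A\otimes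 A\to A$ such that, setting $x\circ_A y=x\triangleright_A y+x\triangleleft_A y$ and $x\bullet_A y=x\triangleright_A y+y\triangleleft_A x$, $(A,\circ_A)$ is a perm algebra and for all $x,y,z\in A$: $(x\circ_A y)\bullet_A z=x\bullet_A(y\bullet_A z)=y\bullet_A(x\bullet_A z)$ and $z\triangleleft_A(x\circ_A y)=-(z\triangleleft_A y)\triangleleft_A x=x\bullet_A(z\triangleleft_A y)=(x\bullet_A z)\triangleleft_A y$. It is special if $\triangleleft_A$ is commutative. A quadratic special apre-perm algebra $(A,\triangleright_A,\triangleleft_A,\mathcal B)$ is a special apre-perm algebra with a nondegenerate symmetric bilinear form such that $\mathcal B(x\triangleleft_A y,z)=-\mathcal B(x,z\circ_A y)$. A Manin triple of special apre-perm algebras $\big((A\oplus A^*,\triangleright_d,\triangleleft_d,\mathcal B_d),(A,\triangleright_A,\triangleleft_A),(A^*,\triangleright_{A^*},\triangleleft_{A^*})\big)$ consists of special apre-perm algebras on $A$ and $A^*$ and a quadratic special apre-perm algebra $(A\oplus A^*,\triangleright_d,\triangleleft_d,\mathcal B_d)$ containing both as special apre-perm subalgebras (so the operations on $A$ and $A^*$ are the restrictions of $\triangleright_d,\triangleleft_d$). *)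

(* Defs.v *)
From HB Require Import structures.
From mathcomp Require Import all_boot all_order all_algebra.

Set Implicit Arguments.
Unset Strict Implicit.
Unset Printing Implicit Defensive.

Import GRing.Theory.
Local Open Scope ring_scope.

(* The algebras below need not be unital, so their products are plain bilinear
   maps on vectTypes rather than instances of the ring hierarchy. *)

Section Algebras.
Variables (K : fieldType) (V : vectType K).
Implicit Types (m ra la : {bilinear V -> V -> V}) (P : {linear V -> V}).

Record commutative_algebra m : Prop := CommutativeAlgebra {
  comm_algC : commutative m;
  comm_algA : associative m
}.

Definition averaging_operator m P : Prop :=
  forall x y : V, m (P x) (P y) = P (m (P x) y).

Definition perm_algebra m : Prop :=
  forall x y z : V, m x (m y z) = m (m x y) z /\ m (m x y) z = m (m y x) z.

(* [ra] is the multiplication written with a right-pointing triangle, [la] the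
   one written with a left-pointing triangle. *)
Definition circ ra la (x y : V) : V := ra x y + la x y.

Definition bullet ra la (x y : V) : V := ra x y + la y x.

Fact circ_is_bilinear ra la : bilinear_for *:%R *:%R (circ ra la).
Proof.
by split=> z a x y; rewrite /circ /= ?linearPl ?linearPr /= scalerDr addrACA.
Qed.

HB.instance Definition _ ra la :=
  bilinear_isBilinear.Build K V V V *:%R *:%R (circ ra la)
    (circ_is_bilinear ra la).

Record apre_perm_algebra ra la : Prop := AprePermAlgebra {
  apre_perm_circ : perm_algebra (circ ra la);
  apre_perm_bullet : forall x y z : V,
    bullet ra la (circ ra la x y) z = bullet ra la x (bullet ra la y z) /\
    bullet ra la x (bullet ra la y z) = bullet ra la y (bullet ra la x z);
  apre_perm_la : forall x y z : V,
    [/\ la z (circ ra la x y) = - la (la z y) x,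
        - la (la z y) x = bullet ra la x (la z y) &
        bullet ra la x (la z y) = la (bullet ra la x z) y]
}.

Record special_apre_perm_algebra ra la : Prop := SpecialAprePermAlgebra {
  special_apre_perm : apre_perm_algebra ra la;
  special_laC : commutative la
}.

Definition invariant_form m (B : {biscalar V}) : Prop :=
  forall u v w : V, B (m u v) w = B u (m v w).

Record quadratic_special_apre_perm_algebra ra la (B : {biscalar V}) : Prop :=
  QuadraticSpecialAprePermAlgebra {
  quadratic_special : special_apre_perm_algebra ra la;
  quadratic_nondegenerate : forall x : V, (forall y : V, B x y = 0) -> x = 0;
  quadratic_symmetric : forall x y : V, B x y = B y x;
  quadratic_invariant : forall x y z : V,
    B (la x y) z = - B x (circ ra la z y)
}.

End Algebras.

Definition dual_space (K : fieldType) (A : vectType K) : vectType K := 'Hom(A, K^o).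

Definition double_space (K : fieldType) (A : vectType K) : vectType K :=
  (A * dual_space A)%type.

Section Double.
Variables (K : fieldType) (A : vectType K).

Definition transpose (b : 'End(A)) (f : dual_space A) : dual_space A := (f \o b)%VF.

Fact transpose_is_linear (b : 'End(A)) : linear (transpose b).
Proof. by move=> k f g; rewrite /transpose comp_lfunDl comp_lfunZl. Qed.

HB.instance Definition _ (b : 'End(A)) :=
  GRing.isLinear.Build K (dual_space A) (dual_space A) *:%R (transpose b)
    (transpose_is_linear b).

Definition incl (x : A) : double_space A := (x, 0).
Definition incl_dual (a : dual_space A) : double_space A := (0, a).

Definition double_map (phi : {linear A -> A}) (psi : {linear dual_space A -> dual_space A})
  (u : double_space A) : double_space A := (phi u.1, psi u.2).

Fact double_map_is_linear phi psi : linear (double_map phi psi).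
Proof. by move=> k u v; rewrite /double_map /= !linearP. Qed.

HB.instance Definition _ phi psi :=
  GRing.isLinear.Build K (double_space A) (double_space A) *:%R (double_map phi psi)
    (double_map_is_linear phi psi).

Definition Bd (u v : double_space A) : K := v.2 u.1 + u.2 v.1.

Fact Bd_is_bilinear : bilinear_for *%R *%R Bd.
Proof.
by split=> w k u v; rewrite /Bd /= !lfunE /= !lfunE linearP /= mulrDr addrACA.
Qed.

HB.instance Definition _ :=
  bilinear_isBilinear.Build K (double_space A) (double_space A) K *%R *%R Bd
    Bd_is_bilinear.

Record double_construction
    (md : {bilinear double_space A -> double_space A -> double_space A})
    (mA : {bilinear A -> A -> A})
    (mA' : {bilinear dual_space A -> dual_space A -> dual_space A})
    (P Q : 'End(A)) : Prop := DoubleConstruction {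
  dc_alg : commutative_algebra mA;
  dc_alg_dual : commutative_algebra mA';
  dc_alg_double : commutative_algebra md;
  dc_incl : {morph incl : x y / mA x y >-> md x y};
  dc_incl_dual : {morph incl_dual : a b / mA' a b >-> md a b};
  dc_invariant : invariant_form md Bd;
  dc_averaging : averaging_operator mA P;
  dc_averaging_dual : averaging_operator mA' (transpose Q);
  dc_averaging_double : averaging_operator md (double_map P (transpose Q))
}.

Record manin_triple
    (rd ld : {bilinear double_space A -> double_space A -> double_space A})
    (rA lA : {bilinear A -> A -> A})
    (rA' lA' : {bilinear dual_space A -> dual_space A -> dual_space A}) : Prop := ManinTriple {
  manin_alg : special_apre_perm_algebra rA lA;
  manin_alg_dual : special_apre_perm_algebra rA' lA';
  manin_alg_double : quadratic_special_apre_perm_algebra rd ld Bd;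
  manin_incl_ra : {morph incl : x y / rA x y >-> rd x y};
  manin_incl_la : {morph incl : x y / lA x y >-> ld x y};
  manin_incl_dual_ra : {morph incl_dual : a b / rA' a b >-> rd a b};
  manin_incl_dual_la : {morph incl_dual : a b / lA' a b >-> ld a b}
}.

End Double.

(* Main.v *)
Require Import Defs.
From HB Require Import structures.
From mathcomp Require Import all_boot all_order all_algebra.

Set Implicit Arguments.
Unset Strict Implicit.
Unset Printing Implicit Defensive.

Import GRing.Theory.
Local Open Scope ring_scope.

(** Write [m] for the product of [A (+) A^*], [p := P + Q^*] and
    [q := Q + P^*].  The map [q] is the adjoint of [p] for [Bd]
    ([Bd_double_map_adj]).  Pairing the averaging identity
    [p u * p v = p (p u * v)] with an arbitrary vector, and moving every factor
    to the other side by invariance and adjunction, turns it into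
    [p u * q v = q (p u * v) = q (u * q v)] ([admissible_adjoint]), the relation
    saying that [q] is admissible to the averaging algebra.

    For the products [u |> v = p u * v + q (u * v)] and [u <| v = - q (u * v)],
    the terms in [q] cancel both in [u o v = u |> v + u <| v] and, by
    commutativity of [m], in [u . v = u |> v + v <| u]: both are [p u * v].  So
    the axioms on [o] and [.] reduce to the averaging identity, and those on
    [<|] to admissibility ([admissible_special_apre_perm]); invariance of [Bd]
    is once more the adjunction.  Finally [p] and [q] preserve both summands [A]
    and [A^*], so admissibility, and with it the whole construction, restricts
    to each of them ([admissible_inj], [averaging_ra_morph],
    [averaging_la_morph]). *)

Section AveragingAprePerm.
Variables (K : fieldType) (V : vectType K).
Implicit Types (m : {bilinear V -> V -> V}) (p q : {linear V -> V}).

Definition admissible m p q : Prop :=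
  forall x y : V, m (p x) (q y) = q (m (p x) y) /\ q (m (p x) y) = q (m x (q y)).

Definition averaging_ra m p q (x y : V) : V := m (p x) y + q (m x y).

Definition averaging_la m q (x y : V) : V := - q (m x y).

Fact averaging_ra_is_bilinear m p q :
  bilinear_for *:%R *:%R (averaging_ra m p q).
Proof.
by split=> z a x y;
  rewrite /averaging_ra /= ?(linearPl, linearPr, linearP) /=
          ?(linearPl, linearPr, linearP) /= scalerDr addrACA.
Qed.

HB.instance Definition _ m p q :=
  bilinear_isBilinear.Build K V V V *:%R *:%R (averaging_ra m p q)
    (averaging_ra_is_bilinear m p q).

Fact averaging_la_is_bilinear m q : bilinear_for *:%R *:%R (averaging_la m q).
Proof.
by split=> z a x y;
  rewrite /averaging_la /= ?(linearPl, linearPr) /= linearP opprD scalerN.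
Qed.

HB.instance Definition _ m q :=
  bilinear_isBilinear.Build K V V V *:%R *:%R (averaging_la m q)
    (averaging_la_is_bilinear m q).

Lemma circ_averaging m p q x y :
  circ (averaging_ra m p q) (averaging_la m q) x y = m (p x) y.
Proof. by rewrite /circ /= /averaging_ra /averaging_la addrK. Qed.

Lemma bullet_averaging m p q x y : commutative m ->
  bullet (averaging_ra m p q) (averaging_la m q) x y = m (p x) y.
Proof.
by move=> mC; rewrite /bullet /= /averaging_ra /averaging_la (mC y) addrK.
Qed.

(** Both [circ] and [bullet] are [m (p x) y]; averaging makes [p (m (p x) y)]
    symmetric in [x] and [y], which is the perm axiom, and the four expressions
    of the last axiom all become [- q (m (p x) (m z y))] by admissibility. *)
Lemma admissible_special_apre_perm m p q :
  commutative_algebra m -> averaging_operator m p -> admissible m p q ->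
  special_apre_perm_algebra (averaging_ra m p q) (averaging_la m q).
Proof.
case=> mC mA avg adm.
have mCA x y z : m x (m y z) = m y (m x z) by rewrite !mA (mC x).
split; last by move=> x y; rewrite /= /averaging_la mC.
split=> x y z.
- rewrite /= !circ_averaging -!avg; split; first exact: mA.
  by rewrite (mC (p x)).
- by rewrite circ_averaging !bullet_averaging // -avg -mA.
have key : q (m (q (m z y)) x) = q (m (p x) (m z y)).
  by rewrite mC -(adm x _).2.
rewrite circ_averaging !bullet_averaging //= /averaging_la.
rewrite linearNl linearNr /= [q (- _)]linearN opprK key (adm x _).1.
by split=> //; [rewrite mCA | rewrite mA].
Qed.

(** Test each equation against [w] and move everything but [y] into the first
    argument of [B]: the first becomes [B (p (m w (p x))) y = B (m (p w) (p x)) y]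
    and the second [B (m (p w) (p x)) y = B (p (m (p w) x)) y].  Both are the
    averaging identity, read on either side through commutativity of [m]. *)
Lemma admissible_adjoint m p q (B : {biscalar V}) :
  commutative_algebra m -> averaging_operator m p ->
  (forall x, (forall y, B x y = 0) -> x = 0) ->
  (forall x y, B x y = B y x) -> invariant_form m B ->
  (forall x y, B (p x) y = B x (q y)) ->
  admissible m p q.
Proof.
case=> mC mA avg Bnd BC Binv Badj.
have Binj x y : (forall w, B w x = B w y) -> x = y.
  move=> eqB; apply/eqP; rewrite -subr_eq0; apply/eqP/Bnd => w.
  by rewrite BC linearBr /= eqB subrr.
move=> x y; split; apply: Binj => w.
- by rewrite -Binv -!Badj -Binv [m w _]mC -avg mC.
by rewrite -!Badj -!Binv -Badj -avg.
Qed.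

Lemma quadratic_averaging m p q (B : {biscalar V}) :
  commutative_algebra m -> averaging_operator m p ->
  (forall x, (forall y, B x y = 0) -> x = 0) ->
  (forall x y, B x y = B y x) -> invariant_form m B ->
  (forall x y, B (p x) y = B x (q y)) ->
  quadratic_special_apre_perm_algebra (averaging_ra m p q) (averaging_la m q) B.
Proof.
move=> malg avg Bnd BC Binv Badj; split=> // [|x y z].
  apply: admissible_special_apre_perm => //.
  exact: admissible_adjoint Bnd BC Binv Badj.
rewrite circ_averaging /averaging_la /= linearNl /=.
by rewrite BC -Badj BC Binv (comm_algC malg y).
Qed.

End AveragingAprePerm.

Section Subalgebra.
Variables (K : fieldType) (V W : vectType K) (i : {linear V -> W}).
Variables (m : {bilinear V -> V -> V}) (p q : {linear V -> V}).
Variables (m' : {bilinear W -> W -> W}) (p' q' : {linear W -> W}).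
Hypotheses (im : {morph i : x y / m x y >-> m' x y}).
Hypotheses (ip : {morph i : x / p x >-> p' x}).
Hypotheses (iq : {morph i : x / q x >-> q' x}).

Lemma admissible_inj : injective i -> admissible m' p' q' -> admissible m p q.
Proof.
move=> i_inj adm x y; have [e1 e2] := adm (i x) (i y).
by split; apply: i_inj; rewrite !(im, ip, iq).
Qed.

Lemma averaging_ra_morph :
  {morph i : x y / averaging_ra m p q x y >-> averaging_ra m' p' q' x y}.
Proof. by move=> x y; rewrite /averaging_ra linearD iq !im ip. Qed.

Lemma averaging_la_morph :
  {morph i : x y / averaging_la m q x y >-> averaging_la m' q' x y}.
Proof. by move=> x y; rewrite /averaging_la linearN iq im. Qed.

End Subalgebra.

Section Double.
Variables (K : fieldType) (A : vectType K).

Fact incl_is_linear : linear (@incl K A).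
Proof. by move=> k x y; congr pair; rewrite /= scaler0 addr0. Qed.

HB.instance Definition _ :=
  GRing.isLinear.Build K A (double_space A) *:%R (@incl K A) incl_is_linear.

Fact incl_dual_is_linear : linear (@incl_dual K A).
Proof. by move=> k x y; congr pair; rewrite /= scaler0 addr0. Qed.

HB.instance Definition _ :=
  GRing.isLinear.Build K (dual_space A) (double_space A) *:%R (@incl_dual K A)
    incl_dual_is_linear.

Lemma incl_inj : injective (@incl K A).
Proof. by move=> x y []. Qed.

Lemma incl_dual_inj : injective (@incl_dual K A).
Proof. by move=> x y []. Qed.

Lemma double_map_incl (phi : {linear A -> A})
    (psi : {linear dual_space A -> dual_space A}) :
  {morph @incl K A : x / phi x >-> double_map phi psi x}.
Proof. by move=> x; rewrite /double_map /= linear0. Qed.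

Lemma double_map_incl_dual (phi : {linear A -> A})
    (psi : {linear dual_space A -> dual_space A}) :
  {morph @incl_dual K A : a / psi a >-> double_map phi psi a}.
Proof. by move=> a; rewrite /double_map /= linear0. Qed.

Lemma BdC (u v : double_space A) : Bd u v = Bd v u.
Proof. exact: addrC. Qed.

Lemma Bd_nondegenerate (u : double_space A) :
  (forall v : double_space A, Bd u v = 0) -> u = 0.
Proof.
case: u => x a Bu0.
have a0 : a = 0.
  apply/lfunP => y; have := Bu0 (y, 0).
  by rewrite /Bd /= !lfunE /= add0r.
suff x0 : x = 0 by rewrite x0 a0.
(* Coordinate forms on a basis of A separate its points. *)
rewrite (coord_vbasis (memvf x)) big1 // => i _.
have := Bu0 (0, linfun (coord (vbasis fullv) i : A -> K^o)).
by rewrite /Bd /= linear0 addr0 lfunE /= => ->; rewrite scale0r.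
Qed.

Lemma Bd_double_map_adj (P Q : 'End(A)) (u v : double_space A) :
  Bd (double_map P (transpose Q) u) v = Bd u (double_map Q (transpose P) v).
Proof. by rewrite /Bd /double_map /transpose /= !comp_lfunE. Qed.

End Double.

Theorem proposition4p3 (K : closedFieldType) (charK0 : [pchar K] =i pred0)
    (A : vectType K)
    (md : {bilinear double_space A -> double_space A -> double_space A})
    (mA : {bilinear A -> A -> A})
    (mA' : {bilinear dual_space A -> dual_space A -> dual_space A})
    (P Q : 'End(A))
    (Hdc : double_construction md mA mA' P Q) :
  exists (rd ld : {bilinear double_space A -> double_space A -> double_space A})
         (rA lA : {bilinear A -> A -> A})
         (rA' lA' : {bilinear dual_space A -> dual_space A -> dual_space A}),
    manin_triple rd ld rA lA rA' lA' /\
    forall (x y : A) (a b : dual_space A),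
      rd (x, a) (y, b) =
        md (double_map P (transpose Q) (x, a)) (y, b)
        + double_map Q (transpose P) (md (x, a) (y, b)) /\
      ld (x, a) (y, b) =
        - double_map Q (transpose P) (md (x, a) (y, b)).
Proof.
case: Hdc => algA algA' algd im im' Binv avgA avgA' avgd.
pose p : {linear double_space A -> double_space A} := double_map P (transpose Q).
pose q : {linear double_space A -> double_space A} := double_map Q (transpose P).
have adm : admissible md p q.
  exact: admissible_adjoint algd avgd (@Bd_nondegenerate K A) (@BdC K A) Binv
    (Bd_double_map_adj P Q).
have ip := double_map_incl P (transpose Q).
have iq := double_map_incl Q (transpose P).
have ip' := double_map_incl_dual P (transpose Q).
have iq' := double_map_incl_dual Q (transpose P).
exists (averaging_ra md p q), (averaging_la md q).
exists (averaging_ra mA P Q), (averaging_la mA Q).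
exists (averaging_ra mA' (transpose Q) (transpose P)),
       (averaging_la mA' (transpose P)).
split=> //; split.
- apply: admissible_special_apre_perm => //.
  exact: admissible_inj im ip iq (@incl_inj K A) adm.
- apply: admissible_special_apre_perm => //.
  exact: admissible_inj im' ip' iq' (@incl_dual_inj K A) adm.
- exact: quadratic_averaging algd avgd (@Bd_nondegenerate K A) (@BdC K A) Binv
    (Bd_double_map_adj P Q).
- exact: averaging_ra_morph im ip iq.
- exact: averaging_la_morph im iq.
- exact: averaging_ra_morph im' ip' iq'.
- exact: averaging_la_morph im' iq'.
Qed.
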